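(* Let $(\mathcal{A},\partial)$ be a finitely generated semifree (fully noncommutative) DGA with action filtration over a field $\mathbf{k}$. Then $(\mathcal{A},\partial)$ is acyclic if and only if its characteristic algebra $\mathcal{C}=\mathcal{A}/\mathcal{A}\partial(\mathcal{A})\mathcal{A}$ is trivial (i.e. $\mathcal{C}=0$).
   Context: Let $\mathbf{k}$ be an arbitrary field. $\langle a_1,\dots,a_m\rangle$ denotes the free, fully noncommutative, associative, unital $\mathbf{k}$-algebra on $a_1,\dots,a_m$. A DGA with action filtration is a pair $(\mathcal{A},\partial)$ where $\mathcal{A}=\langle a_1,\dots,a_m\rangle$ comes with a choice of free generators, each having a degree $|a_i|\in\mathbb{Z}/\mu\mathbb{Z}$ (for a fixed integer $\mu$) and an action $\ell(a_i)\in\mathbb{R}_{>0}$. These extend to monomials by $|r|=0$ for $r\in\mathbf{k}$, $|a_{i_1}\cdots a_{i_k}|=|a_{i_1}|+\dots+|a_{i_k}|$, and $\ell(0)=-\infty$, $\ell(r)=0$ for $r\in\mathbf{k}\setminus\{0\}$, $\ell(a_{i_1}\cdots a_{i_k})=\ell(a_{i_1})+\dots+\ell(a_{i_k})$. The map $\partial:\mathcal{A}\to\mathcal{A}$ is $\mathbf{k}$-linear of degree $-1$, satisfies $\partial^2=0$, $\partial|_{\mathbf{k}}=0$, and the graded Leibniz rule $\partial(\mathbf{a}\mathbf{b})=\partial(\mathbf{a})\mathbf{b}+(-1)^{|\mathbf{a}|}\mathbf{a}\,\partial(\mathbf{b})$ for all monomials $\mathbf{a},\mathbf{b}$ (so $\mu$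 is even unless $\operatorname{char}\mathbf{k}=2$, in order that the sign be meaningful). Finally, for every generator $a_i$, each monomial appearing in $\partial(a_i)$ with a non-zero coefficient has action strictly less than $\ell(a_i)$. Acyclic means $H(\mathcal{A},\partial)=\ker\partial/\operatorname{im}\partial=0$. $\mathcal{A}\partial(\mathcal{A})\mathcal{A}$ denotes the two-sided ideal of $\mathcal{A}$ generated by all boundaries $\partial(y)$, $y\in\mathcal{A}$. *)

(* Defs.v *)
From HB Require Import structures.
From mathcomp Require Import all_boot all_order all_algebra.
From mathcomp Require Import boolp reals.
From mathcomp Require Import finmap monalg.

Set Implicit Arguments.
Unset Strict Implicit.
Unset Printing Implicit Defensive.

Import GRing.Theory Num.Theory.
Local Open Scope ring_scope.
Local Open Scope quotient_scope.

Section QuotientByGeneratedIdeal.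
Variables (R : pzRingType) (S : R -> Prop).

(* The two-sided ideal RSR generated by S, as finite sums of products a b c with
   b in S. *)
Definition gen_ideal : {pred R} := fun x =>
  `[< exists2 s : seq (R * R * R), (forall t, t \in s -> S t.1.2) &
        x = \sum_(t <- s) t.1.1 * t.1.2 * t.2 >].

Lemma gen_ideal_zmod_closed : zmod_closed gen_ideal.
Proof.
split=> [|x y /asboolP[s Ss ->] /asboolP[t St ->]]; apply/asboolP.
  by exists [::]; rewrite ?big_nil.
exists (s ++ [seq (- r.1.1, r.1.2, r.2) | r <- t]) => [r|].
  by rewrite mem_cat => /orP[/Ss //|/mapP[q /St Sq ->]].
rewrite big_cat big_map /= -sumrN; congr (_ + _).
by apply: eq_bigr => r _; rewrite !mulNr.
Qed.

HB.instance Definition _ :=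
  GRing.isZmodClosed.Build R gen_ideal gen_ideal_zmod_closed.

Lemma gen_idealMl a x : x \in gen_ideal -> a * x \in gen_ideal.
Proof.
move=> /asboolP[s Ss ->]; apply/asboolP.
exists [seq (a * r.1.1, r.1.2, r.2) | r <- s] => [_ /mapP[r /Ss ? ->] //|].
by rewrite big_map mulr_sumr; apply: eq_bigr => r _; rewrite !mulrA.
Qed.

Lemma gen_idealMr a x : x \in gen_ideal -> x * a \in gen_ideal.
Proof.
move=> /asboolP[s Ss ->]; apply/asboolP.
exists [seq (r.1.1, r.1.2, r.2 * a) | r <- s] => [_ /mapP[r /Ss ? ->] //|].
by rewrite big_map mulr_suml; apply: eq_bigr => r _; rewrite !mulrA.
Qed.

Definition quot_gen := Quotient.quot gen_ideal.

HB.instance Definition _ := GRing.Zmodule.on quot_gen.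

Definition quot_pi (x : R) : quot_gen := \pi_(Quotient.quot gen_ideal) x.

(* The quotient rings of the library are restricted to commutative rings and
   proper ideals, hence the direct construction of the product. *)
Definition quot_mul (x y : quot_gen) : quot_gen :=
  quot_pi (repr (x : Quotient.quot _) * repr (y : Quotient.quot _)).

Lemma quot_piP (x y : R) : reflect (quot_pi x = quot_pi y) (x - y \in gen_ideal).
Proof. by rewrite Quotient.idealrBE; exact: eqP. Qed.

Lemma quot_pi_surj (x : quot_gen) : exists y, x = quot_pi y.
Proof. by exists (repr (x : Quotient.quot _)); rewrite /quot_pi reprK. Qed.

Lemma quot_piD (x y : R) : quot_pi (x + y) = quot_pi x + quot_pi y.
Proof. exact: (Quotient.pi_add gen_ideal x y). Qed.

Lemma quot_piM (x y : R) : quot_pi (x * y) = quot_mul (quot_pi x) (quot_pi y).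
Proof.
rewrite /quot_mul; set x' := repr _; set y' := repr _.
have xx' : x - x' \in gen_ideal by apply/quot_piP; rewrite /quot_pi reprK.
have yy' : y - y' \in gen_ideal by apply/quot_piP; rewrite /quot_pi reprK.
apply/quot_piP; rewrite -(subrKA (x' * y)) -mulrBr -mulrBl.
by apply: rpredD; [exact: gen_idealMr | exact: gen_idealMl].
Qed.

Lemma quot_mulA : associative quot_mul.
Proof.
move=> x y z; case: (quot_pi_surj x) (quot_pi_surj y) (quot_pi_surj z).
by move=> a -> [b ->] [c ->]; rewrite -!quot_piM mulrA.
Qed.

Lemma quot_mul1 : left_id (quot_pi 1) quot_mul.
Proof. by move=> x; have [y ->] := quot_pi_surj x; rewrite -quot_piM mul1r. Qed.

Lemma quot_mulr1 : right_id (quot_pi 1) quot_mul.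
Proof. by move=> x; have [y ->] := quot_pi_surj x; rewrite -quot_piM mulr1. Qed.

Lemma quot_mulDl : left_distributive quot_mul +%R.
Proof.
move=> x y z; case: (quot_pi_surj x) (quot_pi_surj y) (quot_pi_surj z).
by move=> a -> [b ->] [c ->]; rewrite -quot_piD -!quot_piM -quot_piD mulrDl.
Qed.

Lemma quot_mulDr : right_distributive quot_mul +%R.
Proof.
move=> x y z; case: (quot_pi_surj x) (quot_pi_surj y) (quot_pi_surj z).
by move=> a -> [b ->] [c ->]; rewrite -quot_piD -!quot_piM -quot_piD mulrDr.
Qed.

HB.instance Definition _ := GRing.Zmodule_isPzRing.Build quot_gen
  quot_mulA quot_mul1 quot_mulr1 quot_mulDl quot_mulDr.

End QuotientByGeneratedIdeal.

(* {fmonom 'I_m} is the free monoid of words in m letters, so its monoid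
   algebra is the free associative unital algebra k<a_1, ..., a_m>; the word w
   is the basis vector << w >> and a scalar c is c%:MP. *)
Notation free_alg k m := {malg k[{fmonom 'I_m}]}.

(* Additive extension to words of a function given on the letters. *)
Definition word_sum (V : nmodType) (m : nat) (f : 'I_m -> V)
  (w : {fmonom 'I_m}) : V := \sum_(i <- (w : seq 'I_m)) f i.

(* Degrees live in Z/mu; they are represented by integers considered modulo mu.
   With mu = 0, congruence modulo mu is equality and the grading is by Z. *)
Definition homogeneous (k : fieldType) (mu : int) (m : nat)
  (deg : 'I_m -> int) (e : int) (x : free_alg k m) : Prop :=
  forall w, w \in msupp x -> (word_sum deg w = e %[mod mu])%Z.

Record filtered_dga (k : fieldType) (R : realType) (mu : int) (m : nat) :=
  FilteredDGA {
  gen_deg : 'I_m -> int;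
  gen_act : 'I_m -> R;
  dga_diff : {linear free_alg k m -> free_alg k m};
  gen_act_gt0 : forall i, 0 < gen_act i;
  (* (-1)^e in k depends only on the class of e modulo mu. *)
  sign_meaningful : (2 %| mu)%Z \/ 2%N \in [pchar k];
  diff_degree : forall (e : int) (x : free_alg k m),
    homogeneous mu gen_deg e x -> homogeneous mu gen_deg (e - 1) (dga_diff x);
  diffK : forall x, dga_diff (dga_diff x) = 0;
  diffC : forall c : k, dga_diff (c%:MP) = 0;
  diffM : forall u v : {fmonom 'I_m},
    dga_diff (<< u >> * << v >>) =
      dga_diff << u >> * << v >>
      + (-1 : k) ^ word_sum gen_deg u *: (<< u >> * dga_diff << v >>);
  diff_act : forall i w, w \in msupp (dga_diff << fmu i >>) ->
    word_sum gen_act w < gen_act i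
}.

Section Homology.
Context (k : fieldType) (R : realType) (mu : int) (m : nat).
Variable A : filtered_dga k R mu m.

Definition is_cycle : {pred free_alg k m} := [pred x | dga_diff A x == 0].

Lemma is_cycle_zmod_closed : zmod_closed is_cycle.
Proof.
split=> [|x y]; first by rewrite inE linear0.
by rewrite !inE => /eqP dx /eqP dy; rewrite linearB dx dy subrr.
Qed.

HB.instance Definition _ :=
  GRing.isZmodClosed.Build (free_alg k m) is_cycle is_cycle_zmod_closed.

Record cycles := Cycle { cycle_val :> free_alg k m; _ : cycle_val \in is_cycle }.

HB.instance Definition _ := [isSub for cycle_val].
HB.instance Definition _ := [Choice of cycles by <:].
HB.instance Definition _ := [SubChoice_isSubZmodule of cycles by <:].

Definition is_boundary : {pred cycles} :=
  fun z => `[< exists y, cycle_val z = dga_diff A y >].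

Lemma is_boundary_zmod_closed : zmod_closed is_boundary.
Proof.
split=> [|x y /asboolP[u du] /asboolP[v dv]]; apply/asboolP.
  by exists 0; rewrite linear0.
by exists (u - v); rewrite linearB -du -dv.
Qed.

HB.instance Definition _ :=
  GRing.isZmodClosed.Build cycles is_boundary is_boundary_zmod_closed.

Definition homology := Quotient.quot is_boundary.

Definition acyclic : Prop := forall h : homology, h = 0.

End Homology.

Arguments is_boundary {k R mu m} A _.

Definition char_algebra (k : fieldType) (R : realType) (mu : int) (m : nat)
    (A : filtered_dga k R mu m) : pzRingType :=
  quot_gen (fun b : free_alg k m => exists y, b = dga_diff A y).

(* Main.v *)
(* If the homology H of A is non-zero, the characteristic algebra is non-zero
   because A has a non-zero representation killing all boundaries.  Choose a
   complement W of the boundaries in the cycles, so that W is isomorphic to H.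
   The cone K = A (+) W with d (v, w) = (d v + w, 0) is acyclic and contains A
   as a subcomplex whose quotient W has zero differential.  Since A is free,
   left multiplication A -> End A lifts along the restriction of endomorphisms
   from K to A, one generator at a time in order of increasing action: the
   obstruction to lifting a_i is a cycle in Hom (W, K), which is a boundary.
   The result is F : A -> End K with
     d F(x) = F(d x) + (-1)^|x| F(x) d,
   hence every F(d b) maps K into A and A acts on K / A = W through its
   characteristic algebra.  If 1 = sum a (d b) c then W = 0. *)
From HB Require Import structures.
Require Import Defs.
From mathcomp Require Import all_boot all_order all_algebra.
From mathcomp Require Import boolp classical_sets reals.
From mathcomp Require Import finmap monalg.

Set Implicit Arguments.
Unset Strict Implicit.
Unset Printing Implicit Defensive.

Import Order.TTheory GRing.Theory Num.Theory.
Local Open Scope ring_scope.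

(** * Complements, projections and generalized inverses over a field *)

Section LinearAlgebra.
Variable k : fieldType.

Lemma exists_complement (V : lmodType k) (U : V -> Prop) :
    U 0 -> (forall a x y, U x -> U y -> U (a *: x + y)) ->
  exists2 W : V -> Prop,
    W 0 /\ (forall a x y, W x -> W y -> W (a *: x + y)) &
    (forall x, W x -> U x -> x = 0) /\ (forall x, exists2 w, W w & U (x - w)).
Proof.
move=> U0 UL.
(* [P] does not ask for 0 in [W], as the union of the empty chain is empty; maximality supplies 0
   afterwards. *)
pose P (W : set V) := (forall a x y, W x -> W y -> W (a *: x + y)) /\
  (forall x, W x -> U x -> x = 0).
have [F FP Ftot|W [[WL WU] Wmax]] := @Zorn_bigcup V P.
  split=> [a x y [X FX Xx] [Y FY Yy]|x [X FX Xx]]; last exact: (FP _ FX).2.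
  have [XY|YX] := Ftot _ _ FX FY.
    by exists Y => //; apply: (FP _ FY).1 => //; exact: XY.
  by exists X => //; apply: (FP _ FX).1 => //; exact: YX.
have W0 : W 0.
  apply: contrapT => nW0; apply: (Wmax [set x | W x \/ x = 0]%classic).
    by split=> [x ?|WW]; [left | apply: nW0; apply: WW; right].
  split=> [a x y [Wx|->] [Wy|->]|x [/WU//|//]].
  - by left; exact: WL.
  - left; suff -> : a *: x + 0 = (a - 1) *: x + x by exact: WL.
    by rewrite addr0 scalerBl scale1r subrK.
  - by left; rewrite scaler0 add0r.
  - by right; rewrite scaler0 addr0.
have UZ a x : U x -> U (a *: x) by move=> Ux; rewrite -[_ *: _]addr0; exact: UL.
have WZ a x : W x -> W (a *: x) by move=> Wx; rewrite -[_ *: _]addr0; exact: WL.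
exists W; split=> // x; apply: contrapT => nx.
(* Adjoin [x] to [W]: if some a x + w with a nonzero lay in [U], then [x] would already split as
   wanted. *)
apply: (Wmax [set y | exists2 w, W w & exists a, y = a *: x + w]%classic).
  split=> [w Ww|WW]; first by exists w => //; exists 0; rewrite scale0r add0r.
  apply: nx; exists x; last by rewrite subrr.
  by apply: WW; exists 0 => //; exists 1; rewrite scale1r addr0.
split=> [c _ _ [w Ww [a ->]] [w' Ww' [a' ->]]|_ [w Ww [a ->]]].
  exists (c *: w + w'); first exact: WL.
  by exists (c * a + a'); rewrite scalerDr scalerDl scalerA addrACA.
have [->|a0 Uy] := eqVneq a 0; first by rewrite scale0r add0r; exact: WU.
case: nx; exists (- a^-1 *: w); first exact: WZ.
have := UZ a^-1 _ Uy.
by rewrite scalerDr scalerA mulVf // scale1r scaleNr opprK.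
Qed.

(** The component in a complement of [U] is unique, since two candidates differ by an element of
    both subspaces; uniqueness makes the chosen map linear. *)
Lemma exists_projection (V : lmodType k) (U : V -> Prop) :
    U 0 -> (forall a x y, U x -> U y -> U (a *: x + y)) ->
  exists p : {linear V -> V},
    (forall x, U (x - p x)) /\ (forall x, U x -> p x = 0).
Proof.
move=> U0 UL; have [W [W0 WL] [WU WE]] := exists_complement U0 UL.
have [|p pP] := @choice _ _ (fun x w => W w /\ U (x - w)).
  by move=> x; have [w] := WE x; exists w.
have UB x y : U x -> U y -> U (x - y).
  by move=> Ux Uy; rewrite addrC -scaleN1r; exact: UL.
have WB x y : W x -> W y -> W (x - y).
  by move=> Ux Uy; rewrite addrC -scaleN1r; exact: WL.
have pE x w : W w -> U (x - w) -> p x = w.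
  move=> Ww Uw; have [Wp Up] := pP x; apply/eqP; rewrite -subr_eq0; apply/eqP.
  apply: WU; first exact: WB.
  suff -> : p x - w = (x - w) - (x - p x) by exact: UB.
  by rewrite opprB [RHS]addrC subrKA.
have p_lin : linear p.
  move=> a x y; apply: pE; first by apply: WL; apply: (pP _).1.
  by rewrite opprD addrACA -scalerBr; apply: UL; apply: (pP _).2.
pose pL := GRing.isLinear.Build k V V *:%R p p_lin.
pose q : {linear V -> V} := HB.pack p pL.
exists q; split=> [x|x Ux]; first exact: (pP x).2.
by apply: pE; rewrite ?subr0.
Qed.

Lemma exists_generalized_inverse (V W : lmodType k) (g : {linear V -> W}) :
  exists h : {linear W -> V}, forall x, g (h (g x)) = g x.
Proof.
have [||p [pP p0]] := @exists_projection W (fun y => exists x, y = g x).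
- by exists 0; rewrite linear0.
- by move=> a _ _ [x ->] [y ->]; exists (a *: x + y); rewrite linearP.
have [||q [qP q0]] := @exists_projection V (fun x => g x = 0).
- by rewrite linear0.
- by move=> a x y gx gy; rewrite linearP gx gy scaler0 addr0.
(* [h] picks arbitrary preimages and need not be linear; [q] takes equal values on elements with
   equal image under [g], so [q \o h] is linear. *)
have [h hP] := choice pP.
have gq x : g (q x) = g x by apply/esym/eqP; rewrite -subr_eq0 -linearB qP.
have qE x y : g x = g y -> q x = q y.
  move=> gxy; apply/eqP; rewrite -subr_eq0 -linearB q0 //.
  by rewrite linearB gxy subrr.
have h_lin : linear (q \o h).
  move=> a x y /=; rewrite -linearP; apply: qE.
  by rewrite linearP -!hP linearP opprD addrACA scalerBr.
pose hL := GRing.isLinear.Build k W V *:%R (q \o h) h_lin.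
pose H : {linear W -> V} := HB.pack (q \o h) hL.
exists H => x /=; rewrite gq -hP p0 ?subr0 //; by exists x.
Qed.

End LinearAlgebra.

(** * The action of the free algebra given by operators for the letters *)

Section FreeAlgebraAction.
Variables (k : fieldType) (m : nat).
Local Notation alg := (free_alg k m).
Local Notation word := {fmonom 'I_m}.

Lemma scale_word a c (w : word) : a *: << c *g w >> = << a * c *g w >> :> alg.
Proof. by apply/malgP => u; rewrite mcoeffZ !mcoeffU mulrnAr. Qed.

Lemma free_algE (x : alg) : x = \sum_(w <- msupp x) x@_w *: << w >>.
Proof.
by rewrite {1}[x]monalgE; apply: eq_bigr => w _; rewrite scale_word mulr1.
Qed.

Lemma mul_word (u v : word) : << u >> * << v >> = << mmul u v >> :> alg.
Proof. by rewrite malgM_def fgmulUU mulr1. Qed.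

(* The library only declares {malg k[M]} a left algebra. *)
Lemma free_alg_scalerAr a (x y : alg) : x * (a *: y) = a *: (x * y).
Proof.
rewrite (free_algE x) (free_algE y) !mulr_suml [RHS]scaler_sumr.
apply: eq_bigr => u _; rewrite scaler_sumr !mulr_sumr [RHS]scaler_sumr.
apply: eq_bigr => w _.
rewrite scalerA !scale_word !malgM_def !fgmulUU scale_word.
by rewrite !mulr1 mulrCA.
Qed.

Variable V : lmodType k.

Definition word_act (f : 'I_m -> {linear V -> V}) (w : word) (v : V) : V :=
  foldr (fun i => f i) v (w : seq 'I_m).

(** The algebra morphism to End [V] with value [f i] on the i-th letter, evaluated at [v]. *)
Definition alg_act (f : 'I_m -> {linear V -> V}) (x : alg) (v : V) : V :=
  \sum_(w <- msupp x) x@_w *: word_act f w v.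

Lemma eq_word_act f g (w : word) v :
  (forall i, i \in (w : seq 'I_m) -> f i = g i) ->
  word_act f w v = word_act g w v.
Proof.
rewrite /word_act; elim: (w : seq _) => //= i s IH fg.
by rewrite IH => [|j js]; rewrite fg ?inE ?eqxx ?js ?orbT.
Qed.

(** Allows [f] to be redefined on generators that do not occur in [x]. *)
Lemma eq_alg_act f g (x : alg) v :
    (forall w i, w \in msupp x -> i \in (w : seq 'I_m) -> f i = g i) ->
  alg_act f x v = alg_act g x v.
Proof.
move=> fg; apply: eq_big_seq => w wx; congr (_ *: _).
by apply: eq_word_act => i; exact: fg.
Qed.

Variable f : 'I_m -> {linear V -> V}.

Lemma word_actM (u w : word) v :
  word_act f (mmul u w) v = word_act f u (word_act f w v).
Proof. by rewrite /word_act fmM foldr_cat. Qed.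

Lemma word_actP (w : word) a v v' :
  word_act f w (a *: v + v') = a *: word_act f w v + word_act f w v'.
Proof. by rewrite /word_act; elim: (w : seq _) => //= i s ->; rewrite linearP. Qed.

Lemma alg_actEw (d : {fset word}) (x : alg) v : (msupp x `<=` d)%fset ->
  alg_act f x v = \sum_(w <- d) x@_w *: word_act f w v.
Proof.
move=> le; rewrite /alg_act (big_fset_incl _ le) // => w _ wx.
by rewrite mcoeff_outdom // scale0r.
Qed.

Lemma alg_act_linearl v : linear (fun x => alg_act f x v).
Proof.
move=> a x y; pose d := (msupp x `|` msupp y)%fset.
have le : (msupp (a *: x + y)%R `<=` d)%fset.
  apply: fsubset_trans (msuppD_le _ _) _.
  by apply: fsetUSS => //; exact: msuppZ_le.
rewrite (alg_actEw _ le) (@alg_actEw d x) ?fsubsetUl //.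
rewrite (@alg_actEw d y) ?fsubsetUr // scaler_sumr -big_split /=.
by apply: eq_bigr => w _; rewrite mcoeffD mcoeffZ scalerDl scalerA.
Qed.

Lemma alg_act_linearr x : linear (alg_act f x).
Proof.
move=> a v v'; rewrite /alg_act scaler_sumr -big_split /=.
apply: eq_bigr => w _.
by rewrite word_actP scalerDr !scalerA [a * _]mulrC.
Qed.

HB.instance Definition _ x := GRing.isLinear.Build k V V *:%R
  (alg_act f x) (alg_act_linearr x).

Lemma alg_act0l v : alg_act f 0 v = 0.
Proof. by rewrite /alg_act msupp0 big_seq_fset0. Qed.

Lemma alg_actDl x y v : alg_act f (x + y) v = alg_act f x v + alg_act f y v.
Proof. by have := alg_act_linearl v 1 x y; rewrite !scale1r. Qed.

Lemma alg_actZl a x v : alg_act f (a *: x) v = a *: alg_act f x v.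
Proof. by have := alg_act_linearl v a x 0; rewrite !addr0 alg_act0l addr0. Qed.

Lemma alg_act_suml (I : Type) (r : seq I) (F : I -> alg) v :
  alg_act f (\sum_(i <- r) F i) v = \sum_(i <- r) alg_act f (F i) v.
Proof.
elim: r => [|i r IH]; first by rewrite !big_nil alg_act0l.
by rewrite !big_cons alg_actDl IH.
Qed.

Lemma alg_actU w v : alg_act f << w >> v = word_act f w v.
Proof. by rewrite /alg_act msuppU1 big_seq_fset1 mcoeffUU scale1r. Qed.

Lemma alg_act1 v : alg_act f 1 v = v.
Proof. by rewrite alg_actU /word_act fm1. Qed.

Lemma alg_actM x y v : alg_act f (x * y) v = alg_act f x (alg_act f y v).
Proof.
rewrite {1}(free_algE x) mulr_suml alg_act_suml; apply: eq_bigr => u _.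
rewrite -scalerAl alg_actZl; congr (_ *: _).
rewrite {1}(free_algE y) mulr_sumr alg_act_suml -alg_actU linear_sum /=.
apply: eq_bigr => w _.
by rewrite free_alg_scalerAr linearZ /= alg_actZl mul_word !alg_actU word_actM.
Qed.

End FreeAlgebraAction.

(** For even [mu], congruent exponents have equal parity; in characteristic 2, -1 = 1. *)
Lemma sign_congr (k : fieldType) (mu e e' : int) :
    (2 %| mu)%Z \/ 2%N \in [pchar k] -> (e = e' %[mod mu])%Z ->
  (-1 : k) ^ e = (-1) ^ e'.
Proof.
move=> sgn /eqP; rewrite eqz_mod_dvd => ee'.
suff : (-1 : k) ^ (e - e') = 1.
  move=> ee1; rewrite -[in LHS](subrKC e' e) expfzDr ?oppr_eq0 ?oner_eq0 //.
  by rewrite ee1 mulr1.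
case: sgn => [mu2|k2]; last first.
  by rewrite oppr_pchar2 // exp1rz.
have /dvdzP[q ->] : (2 %| e - e')%Z by exact: dvdz_trans ee'.
by rewrite mulrC -exprz_exp -exprnP sqrrN expr1n exp1rz.
Qed.

Lemma gen_idealP (R : pzRingType) (S : R -> Prop) :
  (forall c : quot_gen S, c = 0) <-> 1 \in gen_ideal S.
Proof.
have pi0 (x : R) : quot_pi S x = 0 <-> x \in gen_ideal S.
  have {1}<- : quot_pi S 0 = 0 by exact: pi_zeror.
  by rewrite -{2}[x]subr0; split=> /quot_piP.
split=> [C0|I1 c]; first exact/pi0/C0.
have [x ->] := quot_pi_surj c; apply/pi0.
by rewrite -[x]mulr1; exact: gen_idealMl.
Qed.

(** * Signs, actions and the Leibniz rule on words *)

Section Dga.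
Context (k : fieldType) (R : realType) (mu : int) (m : nat).
Variable A : filtered_dga k R mu m.
Local Notation alg := (free_alg k m).
Local Notation word := {fmonom 'I_m}.
Local Notation bd := (dga_diff A).
Local Notation sgn w := ((-1 : k) ^ word_sum (gen_deg A) w).
Local Notation gsgn i := ((-1 : k) ^ gen_deg A i).

Lemma acyclicP : acyclic A <-> forall z, bd z = 0 -> exists y, z = bd y.
Proof.
have pi0 (z : cycles A) :
    \pi_(Quotient.quot (is_boundary A))%qT z = 0 <-> z \in is_boundary A.
  have {1}<- : \pi_(Quotient.quot (is_boundary A))%qT 0 = 0 by exact: pi_zeror.
  by rewrite -{2}[z]subr0 Quotient.idealrBE; split=> /eqP.
split=> [H0 z z0|H0 h].
  have zc : z \in is_cycle A by rewrite inE z0.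
  by have /pi0/asboolP := H0 (\pi_(Quotient.quot (is_boundary A))%qT (Cycle zc)).
rewrite -[h]reprK; apply/pi0; case: (repr _) => z zc.
by apply/asboolP/H0; exact/eqP.
Qed.

Lemma word_sum1 (V : nmodType) (F : 'I_m -> V) : word_sum F mone = 0.
Proof. by rewrite /word_sum fm1 big_nil. Qed.

Lemma word_sumU (V : nmodType) (F : 'I_m -> V) i : word_sum F (fmu i) = F i.
Proof. by rewrite /word_sum fmU big_seq1. Qed.

Lemma word_sumM (V : nmodType) (F : 'I_m -> V) u w :
  word_sum F (mmul u w) = word_sum F u + word_sum F w.
Proof. by rewrite /word_sum fmM big_cat. Qed.

Lemma word_ind (P : word -> Prop) :
  P mone -> (forall i w, P w -> P (mmul (fmu i) w)) -> forall w, P w.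
Proof.
move=> P1 PM [s]; elim: s => [|i s IH]; first by rewrite -fmoneE.
suff -> : FMonom (i :: s) = mmul (fmu i) (FMonom s) by exact: PM.
by apply/eqP; rewrite fmP fmM fmU.
Qed.

(** Since [bd] lowers degrees by one, all words in the differential of a generator share one sign,
    which can leave the sum. *)
Lemma sgn_diff_gen i w : w \in msupp (bd << fmu i >>) -> sgn w = - gsgn i.
Proof.
move=> wi; have h : homogeneous mu (gen_deg A) (gen_deg A i) (<< fmu i >> : alg).
  by move=> u; rewrite msuppU1 in_fset1 => /eqP ->; rewrite word_sumU.
have := diff_degree h wi => /(sign_congr (sign_meaningful A)) ->.
by rewrite expfzDr ?oppr_eq0 ?oner_eq0 // exprN1 invrN1 mulrN1.
Qed.

(** Positivity bounds the action of a letter by that of any word containing it; this orders the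
    recursive lifting. *)
Lemma diff_gen_letter_lt i j w :
  w \in msupp (bd << fmu i >>) -> j \in (w : seq 'I_m) -> gen_act A j < gen_act A i.
Proof.
move=> /diff_act wi jw; apply: le_lt_trans wi; rewrite /word_sum (big_rem j) //=.
by rewrite lerDl sumr_ge0 // => l _; exact/ltW/gen_act_gt0.
Qed.

Lemma diff_word_mul (u : word) (x : alg) :
  bd (<< u >> * x) = bd << u >> * x + sgn u *: (<< u >> * bd x).
Proof.
rewrite (free_algE x) mulr_sumr !(linear_sum bd) /= !mulr_sumr.
rewrite scaler_sumr -big_split /=; apply: eq_bigr => w _.
rewrite !linearZ /= !free_alg_scalerAr linearZ /= diffM.
by rewrite scalerDr !scalerA [_ * x@_w]mulrC.
Qed.

(** * The cone and the lifting of left multiplication to it *)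

Section Cone.
Variable h : {linear alg -> alg}.
Hypothesis bdK : forall x, bd (h (bd x)) = bd x.

(* The cycles killed by bd \o h form a complement of the boundaries. *)
Definition harmonic (w : alg) := bd w = 0 /\ bd (h w) = 0.

Lemma harmonicP a x y : harmonic x -> harmonic y -> harmonic (a *: x + y).
Proof.
move=> [x0 hx0] [y0 hy0].
by rewrite /harmonic !linearP x0 hx0 y0 hy0 !scaler0 addr0.
Qed.

Lemma harmonic0 : harmonic 0.
Proof. by rewrite /harmonic !linear0. Qed.

Definition cone_inl (v : alg) : alg * alg := (v, 0).

Lemma cone_inl_is_linear : linear cone_inl.
Proof. by move=> a v w; congr (_, _); rewrite /= scaler0 addr0. Qed.

HB.instance Definition _ := GRing.isLinear.Build k alg
  (alg * alg)%type *:%R cone_inl cone_inl_is_linear.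

(** The second component ranges over the whole algebra, so that operators are linear maps of one
    fixed module; W enters through the side condition [harmonic p.2]. *)
Definition cone_diff (p : alg * alg) : alg * alg := cone_inl (bd p.1 + p.2).

Lemma cone_diff_is_linear : linear cone_diff.
Proof.
move=> a p q; congr (_, _); rewrite /= ?scaler0 ?addr0 //.
by rewrite linearP addrACA scalerDr.
Qed.

HB.instance Definition _ := GRing.isLinear.Build k (alg * alg)%type
  (alg * alg)%type *:%R cone_diff cone_diff_is_linear.

Implicit Type f : 'I_m -> {linear (alg * alg)%type -> (alg * alg)%type}.

Definition cone_lift f i (g : {linear (alg * alg)%type -> (alg * alg)%type}) :=
  [/\ forall v, g (cone_inl v) = cone_inl (<< fmu i >> * v),
      forall p, harmonic p.2 -> harmonic (g p).2 &
      forall p, harmonic p.2 -> cone_diff (g p) =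
        alg_act f (bd << fmu i >>) p + gsgn i *: g (cone_diff p)].

Lemma exists_cone_lift f i :
    (forall v, alg_act f (bd << fmu i >>) (cone_inl v) =
       cone_inl (bd << fmu i >> * v)) ->
    (forall p, harmonic p.2 -> harmonic (alg_act f (bd << fmu i >>) p).2) ->
    (forall p, harmonic p.2 -> cone_diff (alg_act f (bd << fmu i >>) p) =
       - gsgn i *: alg_act f (bd << fmu i >>) (cone_diff p)) ->
  exists g, cone_lift f i g.
Proof.
set X := << fmu i >>; set B := bd X; set s := gsgn i => actl act_harm act_anti.
(* On (0, w) the equation for [g] prescribes the differential B (0, w) + s (X w, 0); [r w] is its
   first component. *)
pose r w := (alg_act f B (0, w)).1 + s *: (X * w).
have r_lin a w w' : r (a *: w + w') = a *: r w + r w'.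
  have e : (0, a *: w + w') = a *: (0, w) + (0, w') :> alg * alg.
    by congr (_, _); rewrite /= scaler0 addr0.
  rewrite /r e linearP /= mulrDr free_alg_scalerAr !scalerDr !scalerA mulrC.
  by rewrite addrACA.
(* The W-dependent part of g is a primitive of r w in the cone. *)
pose g (p : alg * alg) := (X * p.1 + h (r p.2), r p.2 - bd (h (r p.2))).
have g_lin : linear g.
  move=> a p q; rewrite /g /= r_lin !linearP /= mulrDr free_alg_scalerAr.
  congr (_, _); first by rewrite /= scalerDr addrACA.
  by rewrite /= addrACA -scalerDr.
(* The second component of B (0, w) is harmonic and equals - bd (r w); a harmonic boundary is 0 by
   [bdK]. *)
have rP w : harmonic w -> bd (r w) = 0 /\ (alg_act f B (0, w)).2 = 0.
  move=> hw; have hb := act_harm (0, w) hw; have /(congr1 fst) := act_anti (0, w) hw.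
  rewrite /cone_diff /= linear0 add0r actl /=; set b := (alg_act _ _ _).2 => ab.
  have rb : bd (r w) = - b.
    rewrite /r linearD linearZ /= diff_word_mul hw.1 mulr0 scaler0 addr0.
    apply/eqP; rewrite -subr_eq0 opprK addrAC ab scaleNr addNr //.
  have := hb.2; rewrite -/b -[b]opprK -rb !linearN /= bdK rb opprK.
  by move=> b0; rewrite b0 oppr0.
pose gL := GRing.isLinear.Build k (alg * alg)%type (alg * alg)%type *:%R g g_lin.
pose G : {linear (alg * alg)%type -> (alg * alg)%type} := HB.pack g gL.
have r0 : r 0 = 0 by have := r_lin (-1) 0 0; rewrite scaleN1r addNr scaleN1r addNr.
exists G; split=> [v|[v w] /= hw|[v w] /= hw].
- by rewrite /= /g /= r0 !linear0 ?addr0; congr (_, _).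
- by have [rw _] := rP _ hw; rewrite /harmonic !linearB /= diffK bdK rw !subrr.
have [rw b0] := rP _ hw.
have e : (v, w) = cone_inl v + (0, w) :> alg * alg.
  by congr (_, _); rewrite /= ?addr0 ?add0r.
rewrite [in RHS]e linearD /= actl /g /= r0 !linear0 !addr0 add0r /cone_diff /=.
congr (_, _); last by rewrite /= b0 add0r scaler0 addr0; exact: erefl.
rewrite /= (linearD bd) /= diff_word_mul mulrDr scalerDr word_sumU -/s -/B -/X.
by rewrite addrACA subrr addr0 /r addrACA.
Qed.

Lemma word_act_inl f (w : word) v :
    (forall i, i \in (w : seq 'I_m) -> cone_lift f i (f i)) ->
  word_act f w (cone_inl v) = cone_inl (<< w >> * v).
Proof.
elim/word_ind: w => [|i w IH] fw; first by rewrite /word_act fm1 mul1r.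
have [fi _ _] : cone_lift f i (f i) by apply: fw; rewrite fmM fmU inE eqxx.
rewrite word_actM IH => [|j jw]; last by apply: fw; rewrite fmM mem_cat jw orbT.
by rewrite /word_act fmU /= fi mulrA mul_word.
Qed.

Lemma word_act_harmonic f (w : word) p :
    (forall i, i \in (w : seq 'I_m) -> cone_lift f i (f i)) ->
  harmonic p.2 -> harmonic (word_act f w p).2.
Proof.
move=> + hp; elim/word_ind: w => [|i w IH] fw; first by rewrite /word_act fm1.
have [_ fi _] : cone_lift f i (f i) by apply: fw; rewrite fmM fmU inE eqxx.
rewrite word_actM /word_act fmU /=; apply/fi/IH => j jw.
by apply: fw; rewrite fmM mem_cat jw orbT.
Qed.

(** By the Leibniz rule the identity passes from two factors to their product, signs multiplying, so
    it suffices to have it on letters. *)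
Lemma word_act_diff f (w : word) p :
    (forall i, i \in (w : seq 'I_m) -> cone_lift f i (f i)) -> harmonic p.2 ->
  cone_diff (word_act f w p) =
    alg_act f (bd << w >>) p + sgn w *: word_act f w (cone_diff p).
Proof.
move=> + hp; elim/word_ind: w => [|i w IH] fw.
  by rewrite /word_act fm1 /= word_sum1 expr0z scale1r (diffC A 1) alg_act0l add0r.
have [_ _ fi] : cone_lift f i (f i) by apply: fw; rewrite fmM fmU inE eqxx.
have {}fw j : j \in (w : seq 'I_m) -> cone_lift f j (f j).
  by move=> jw; apply: fw; rewrite fmM mem_cat jw orbT.
rewrite 2!word_actM -mul_word diff_word_mul alg_actDl alg_actZl.
rewrite (alg_actM f (bd _)) (alg_actM f << fmu i >>).
rewrite (alg_actU f w) (alg_actU f (fmu i)).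
have fiE q : word_act f (fmu i) q = f i q by rewrite /word_act fmU.
rewrite !fiE fi; last exact: word_act_harmonic.
rewrite (IH fw) linearD linearZ /= scalerDr scalerA addrA.
by rewrite word_sumM word_sumU expfzDr ?oppr_eq0 ?oner_eq0.
Qed.

(** * Linear extension from words to elements whose letters are all lifted *)

Section LetterwiseLifted.
Variables (f : 'I_m -> {linear (alg * alg)%type -> (alg * alg)%type}) (x : alg).
Hypothesis fx : forall w i, w \in msupp x -> i \in (w : seq 'I_m) ->
  cone_lift f i (f i).

Lemma alg_act_inl v : alg_act f x (cone_inl v) = cone_inl (x * v).
Proof.
rewrite {2}(free_algE x) mulr_suml linear_sum; apply: eq_big_seq => w wx.
rewrite -scalerAl linearZ /=; congr (_ *: _); apply: word_act_inl => i.
exact: fx.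
Qed.

Lemma alg_act_harmonic p : harmonic p.2 -> harmonic (alg_act f x p).2.
Proof.
move=> hp; rewrite /alg_act big_seq_cond.
elim/big_rec: _ => [|w q /andP[wx _] hq]; first exact: harmonic0.
by apply: harmonicP => //; apply: word_act_harmonic => // i; exact: fx.
Qed.

(** The signs stay inside the sum because [x] need not be homogeneous. *)
Lemma alg_act_diff p : harmonic p.2 ->
  cone_diff (alg_act f x p) = alg_act f (bd x) p +
    \sum_(w <- msupp x) x@_w *: (sgn w *: word_act f w (cone_diff p)).
Proof.
move=> hp; rewrite {2}(free_algE x) !(linear_sum bd) alg_act_suml -big_split /=.
rewrite linear_sum; apply: eq_big_seq => w wx.
rewrite [bd _]linearZ /= alg_actZl -scalerDr linearZ /=; congr (_ *: _).
by apply: word_act_diff => // i; exact: fx.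
Qed.

End LetterwiseLifted.

Lemma cone_lift_step f i :
    (forall j, gen_act A j < gen_act A i -> cone_lift f j (f j)) ->
  exists g, cone_lift f i g.
Proof.
move=> lt_i; have fx w j : w \in msupp (bd << fmu i >>) ->
    j \in (w : seq 'I_m) -> cone_lift f j (f j).
  by move=> wi jw; exact/lt_i/(diff_gen_letter_lt wi jw).
apply: exists_cone_lift => [v|p|p hp]; first exact: alg_act_inl.
  exact: alg_act_harmonic.
(* The first term vanishes by [diffK]; the remaining words all carry the sign [- gsgn i]. *)
rewrite (alg_act_diff fx hp) diffK alg_act0l add0r scaler_sumr.
apply: eq_big_seq => w wx.
by rewrite (sgn_diff_gen wx) !scalerA mulrC.
Qed.

(** Induction on the number of generators of strictly smaller action. Generators of equal action are
    lifted together, as neither occurs in the differential of the other. *)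
Lemma exists_cone_action : exists f, forall i, cone_lift f i (f i).
Proof.
pose rank i := #|[pred j | gen_act A j < gen_act A i]|.
have rank_lt i j : gen_act A j < gen_act A i -> (rank j < rank i)%N.
  move=> ji; apply: proper_card; apply/properP; split.
    by apply/fintype.subsetP => l; rewrite !inE => /lt_trans; apply.
  by exists j; rewrite !inE ?ltxx.
suff [f fP] : exists f, forall i, (rank i < m.+1)%N -> cone_lift f i (f i).
  by exists f => i; apply: fP; rewrite ltnS -[leqRHS]card_ord max_card.
elim: m.+1 => [|n [f fP]].
  by exists (fun=> idfun).
have [|g gP] := @choice _ _ (fun i g => rank i = n -> cone_lift f i g).
  move=> i; have [rn|rn] := eqVneq (rank i) n; last first.
    by exists idfun => /eqP; rewrite (negPf rn).
  have [|g gP] := @cone_lift_step f i; last by exists g.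
  by move=> j /rank_lt; rewrite rn; exact: fP.
pose f' i := if (rank i < n)%N then f i else g i.
exists f' => i ri.
(* Letters of the differential have rank below [n], where [f'] agrees with [f]. *)
have ff' w j : w \in msupp (bd << fmu i >>) -> j \in (w : seq 'I_m) -> f j = f' j.
  move=> wi jw; rewrite /f'; case: ltnP => // nj.
  have := leq_ltn_trans nj (rank_lt _ _ (diff_gen_letter_lt wi jw)).
  by rewrite ltnNge -ltnS ri.
have [f'1 f'2 f'3] : cone_lift f i (f' i).
  rewrite /f'; case: ltnP => [/fP //|ni]; apply: gP; apply/eqP.
  by rewrite eqn_leq ni -ltnS ri.
split=> [||p hp]; [exact: f'1 | exact: f'2 |].
rewrite -(eq_alg_act p ff').
exact: f'3.
Qed.

(* 1 = sum a (d b) c acts as the identity on the cone, while d b maps the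
   cone into the submodule A. *)
Lemma harmonic_eq0 : 1 \in gen_ideal (fun b => exists y, b = bd y) ->
  forall w, harmonic w -> w = 0.
Proof.
have [f fP] := exists_cone_action => /asboolP[s sP s1] w hw.
have fx (x : alg) u i : u \in msupp x -> i \in (u : seq 'I_m) -> cone_lift f i (f i).
  by move=> *; exact: fP.
have act_inl x p : p.2 = 0 -> (alg_act f x p).2 = 0.
  case: p => v z /= ->; have := alg_act_inl (fx x) v.
  by rewrite /cone_inl => ->.
suff : (alg_act f 1 (0, w)).2 = 0 by rewrite alg_act1.
rewrite s1 alg_act_suml big_seq_cond.
elim/big_rec: _ => // t q /andP[/sP[y ty] _] q0.
rewrite /= q0 addr0 !alg_actM ty; apply: (act_inl).
set p := alg_act f t.2 _.
have hp : harmonic p.2 by apply: alg_act_harmonic.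
(* Writes the action of [bd y] on [p] as a cone differential minus words applied to one; both lie in
   the submodule A. *)
have /(canRL (addrK _)) -> := esym (alg_act_diff (fx y) hp).
rewrite /= sub0r raddf_sum big1 ?oppr0 // => u _.
by rewrite /cone_diff word_act_inl //= !scaler0; exact: erefl.
Qed.

End Cone.

End Dga.

Theorem corollary1p2 (k : fieldType) (R : realType) (mu : int) (m : nat)
    (A : filtered_dga k R mu m) :
  acyclic A <-> (forall c : char_algebra A, c = 0).
Proof.
split=> [/acyclicP H0|/gen_idealP I1].
  (* The unit is a cycle, hence a boundary, and so it lies in the ideal. *)
  apply/gen_idealP/asboolP; have [y y1] := H0 1 (diffC A 1).
  exists [:: (1, 1, 1)] => [t|]; last by rewrite big_seq1 !mulr1.
  by rewrite inE => /eqP -> /=; exists y.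
have [h hK] := exists_generalized_inverse (dga_diff A).
apply/acyclicP => z z0; exists (h z); apply/eqP; rewrite -subr_eq0; apply/eqP.
(* For a cycle [z], the difference z - bd (h z) is harmonic because bd h bd = bd. *)
apply: (harmonic_eq0 hK I1).
by rewrite /harmonic !linearB /= z0 diffK hK !subrr.
Qed.
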